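(* Let $L\ge2$ and $0\le N\le L$ be integers and assume that the random vector $X=(X_1,\dots,X_L)$ follows the Fermi-Dirac statistics with $L$ sites and $N$ particles. Denote by $\gamma_L^N\in\mathcal{P}(\mathbb{Z}_+^2)$ the distribution of $(X_1,X_2)$ and let $\lambda^{N/L}\in\mathcal{P}(\mathbb{Z}_+)$ be the Bernoulli distribution with parameter $N/L$. Then $$\Vert\gamma_L^N-\lambda^{N/L}\otimes\lambda^{N/L}\Vert=\frac{2N}{L(L-1)}\Big(1-\frac NL\Big).$$
   Context: $\mathbb{Z}_+$ is the set of non-negative integers. $\mathcal{P}(S)$ is the set of probability measures on a denumerable set $S$, endowed with the total variation distance $\Vert p-q\Vert:=\sup_{A\subseteq S}(p(A)-q(A))=\frac12\sum_{s\in S}|p(\{s\})-q(\{s\})|$. $X=(X_1,\dots,X_L)$ follows the Fermi-Dirac statistics with $L$ sites and $N\le L$ particles if $\mathbb{P}(X_1=x_1,\dots,X_L=x_L)=1/\binom{L}{N}$ when $(x_1,\dots,x_L)\in\{0,1\}^L$ and $\sum_{k=1}^L x_k=N$, and $0$ otherwise. *)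

(* Defs.v *)
From HB Require Import structures.
From mathcomp Require Import all_boot all_order all_algebra.
From mathcomp Require Import all_classical all_reals all_analysis.

Set Implicit Arguments.
Unset Strict Implicit.
Unset Printing Implicit Defensive.

Import Order.TTheory GRing.Theory Num.Theory.
Local Open Scope classical_set_scope.
Local Open Scope ring_scope.

Lemma measurable_nat2 (A : set (nat * nat)) : measurable A.
Proof.
apply: countable_measurable; last exact: countableP.
move=> [i j]; have -> : [set (i, j)] = [set i] `*` [set j].
  by apply/seteqP; split=> [_ ->|[a b] [/= -> ->]].
exact: measurableX.
Qed.

(* Every subset of a denumerable S is an event (for nat * nat with its product
   sigma-algebra this is measurable_nat2), so the supremum is over all A. *)
Definition tv_dist (d : measure_display) (S : measurableType d) (R : realType)
    (p q : probability S R) : \bar R :=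
  ereal_sup [set (p A - q A)%E | A in [set: set S]].

Definition fermi_dirac (d : measure_display) (T : measurableType d)
    (R : realType) (P : probability T R) (L N : nat)
    (X : {RV P >-> L.-tuple nat}) : Prop :=
  forall x : L.-tuple nat,
    P [set w | X w = x] =
      (if [forall k, tnth x k \in [:: 0%N; 1%N]]
            && (\sum_(k < L) tnth x k == N)%N
       then ('C(L, N)%:R)^-1 else 0)%:E.

Arguments fermi_dirac {d T R} P {L} N X.

Definition coord_pair (L : nat) (i j : 'I_L) (x : L.-tuple nat) : nat * nat :=
  (tnth x i, tnth x j).

Lemma measurable_coord_pair (L : nat) (i j : 'I_L) :
  measurable_fun [set: L.-tuple nat] (coord_pair i j).
Proof. by apply: measurable_fun_pair; exact: measurable_tnth. Qed.

HB.instance Definition _ (L : nat) (i j : 'I_L) :=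
  isMeasurableFun.Build _ _ _ _ (coord_pair i j) (measurable_coord_pair i j).

Definition pair_law (d : measure_display) (T : measurableType d)
    (R : realType) (P : probability T R) (L : nat)
    (X : {RV P >-> L.-tuple nat}) (i j : 'I_L) : probability (nat * nat)%type R :=
  distribution P (coord_pair i j \o X).

Arguments pair_law {d T R} P {L} X i j.

Lemma measurable_nat_of_bool : measurable_fun [set: bool] nat_of_bool.
Proof. by []. Qed.

HB.instance Definition _ :=
  isMeasurableFun.Build _ _ _ _ nat_of_bool measurable_nat_of_bool.

(* bernoulli_prob lives on bool; here it is transported to the naturals. *)
Definition bernoulli_nat (R : realType) (p : R) : probability nat R :=
  distribution (bernoulli_prob p) nat_of_bool.

(* Main.v *)
Require Import Defs.
From HB Require Import structures.
From mathcomp Require Import all_boot all_order all_algebra.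
From mathcomp Require Import all_classical all_reals all_analysis.
From mathcomp Require Import ring lra.

Set Implicit Arguments.
Unset Strict Implicit.
Unset Printing Implicit Defensive.

Import Order.TTheory GRing.Theory Num.Theory.
Local Open Scope classical_set_scope.
Local Open Scope ring_scope.

(** Both the law of [(X_1, X_2)] and the product of Bernoulli laws live on the
four points of [{0,1} x {0,1}], and they have the same marginals: an
exchangeable vector of zeros and ones with sum [N] has each coordinate
Bernoulli of parameter [N / L].

Two laws on the square with equal marginals differ by a signed measure whose
rows and columns sum to zero, hence by [-e] on the diagonal and [+e] off the
diagonal for a single number [e]. When [e >= 0] the supremum defining the
distance is attained at the anti-diagonal [{(0,1), (1,0)}] and equals [2 * e]
([tv_dist_bits]). So it only remains to compare the two masses of [(0, 0)].

Under the Fermi-Dirac statistics the set of occupied sites is uniform among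
the [N]-element subsets of the [L] sites ([fermi_dirac_prob]); those avoiding
[b] prescribed sites number ['C(L - b, N)], so these sites are all vacant
with probability ['C(L - b, N) / 'C(L, N)] ([fermi_dirac_vacant]). The case
[b = 1] gives both marginals, and [b = 2] gives
[(1 - N/L) * (1 - N/(L-1))] as mass of [(0, 0)], against [(1 - N/L)^2] for the
product law: thus [e = N / (L * (L-1)) * (1 - N/L)]. *)

(** * Probabilities carried by finitely many points *)

Lemma set_seq_cons (S : eqType) (x : S) (s : seq S) :
  [set` x :: s] = [set x] `|` [set` s].
Proof.
apply/seteqP; split=> y /=; rewrite inE.
  by move=> /orP[/eqP->|ys]; [left|right].
by move=> [->|->]; rewrite ?eqxx ?orbT.
Qed.

Section FiniteSupport.
Context (R : realType) (d : measure_display) (S : measurableType d).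
Hypothesis measurable_all : forall A : set S, measurable A.

Lemma measure_seq (mu : probability S R) (s : seq S) :
  uniq s -> mu [set` s] = (\sum_(x <- s) mu [set x])%E.
Proof.
elim: s => [_|x s IHs /andP[xs us]]; first by rewrite set_nil measure0 big_nil.
rewrite big_cons -IHs// set_seq_cons measureU//.
by apply/seteqP; split=> // y [/= ->]; rewrite (negbTE xs).
Qed.

(** The complement of [s] is null, so only the points of [A] that lie in [s]
contribute. Knowing point masses of total [1] is thus enough to know the whole
law, even on an infinite space. *)
Lemma probability_finite_support (mu : probability S R) (s : seq S)
    (A : set S) :
  uniq s -> mu [set` s] = 1%E ->
  mu A = (\sum_(x <- s | x \in A) mu [set x])%E.
Proof.
move=> us mus.
have nulls : mu (~` [set` s]) = 0%E by rewrite probability_setC// mus subee.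
rewrite -[A in LHS](setUIDK A [set` s]) measureU//=; last first.
  by rewrite setDE setIACA setICr setI0.
have -> : mu (A `\` [set` s]) = 0%E.
  by apply/eqP; rewrite eq_le measure_ge0 andbT -nulls le_measure ?inE.
have -> : A `&` [set` s] = [set` [seq x <- s | x \in A]].
  apply/seteqP; split=> x /=; rewrite mem_filter.
    by move=> [Ax ->]; rewrite andbT mem_set.
  by move=> /andP[/set_mem Ax ->].
by rewrite adde0 measure_seq ?filter_uniq// big_filter.
Qed.

End FiniteSupport.

(** * Total variation distance on the square *)

Local Notation bits := (range nat_of_bool).

(** Equal rows and columns force [mu - nu] to be [-e] at [(0,0)] and [(1,1)] and
[e] at [(0,1)] and [(1,0)]; the best event is the one that collects the two
nonnegative differences. *)
Lemma tv_dist_bits (R : realType) (mu nu : probability (nat * nat)%type R)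
    (e : R) :
  mu (bits `*` bits) = 1%E -> nu (bits `*` bits) = 1%E ->
  mu ([set 0%N] `*` setT) = nu ([set 0%N] `*` setT) ->
  mu (setT `*` [set 0%N]) = nu (setT `*` [set 0%N]) ->
  0 <= e -> nu [set (0, 0)%N] = (mu [set (0, 0)%N] + e%:E)%E ->
  tv_dist mu nu = (2 * e)%:E.
Proof.
move=> mu1 nu1 eql eqr e0 nuE.
pose s : seq (nat * nat) := [:: (0, 0); (0, 1); (1, 0); (1, 1)]%N.
have sE : bits `*` bits = [set` s].
  apply/seteqP; split=> [[_ _] [[/= [] _ <-] [/= [] _ <-]]//|x /=].
  rewrite !inE => /or4P[] /eqP->; split=> /=;
    by [exists false|exists true].
have sumE (p : probability (nat * nat)%type R) : p (bits `*` bits) = 1%E ->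
    forall A, p A = (\sum_(x <- s | x \in A) fine (p [set x]))%:E.
  rewrite sE => p1 A; rewrite -sumEFin.
  rewrite (probability_finite_support measurable_nat2 A _ p1)//.
  apply: eq_bigr => x _; rewrite fineK// fin_num_measure//.
  exact: measurable_nat2.
have muE := sumE _ mu1; have nuE' := sumE _ nu1.
pose m x := fine (mu [set x]); pose n x := fine (nu [set x]).
have m1 : m (0, 0)%N + m (0, 1)%N + m (1, 0)%N + m (1, 1)%N = 1.
  have := muE setT; rewrite probability_setT !big_cons big_nil !in_setT.
  by move=> -[->]; rewrite !addrA addr0.
have n1 : n (0, 0)%N + n (0, 1)%N + n (1, 0)%N + n (1, 1)%N = 1.
  have := nuE' setT; rewrite probability_setT !big_cons big_nil !in_setT.
  by move=> -[->]; rewrite !addrA addr0.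
have rowE (x : nat * nat) : (x \in ([set 0%N] `*` setT)) = (x.1 == 0%N).
  by apply/idP/eqP => [/set_mem[]//|x0]; apply/mem_set; split.
have colE (x : nat * nat) : (x \in (setT `*` [set 0%N])) = (x.2 == 0%N).
  by apply/idP/eqP => [/set_mem[]//|x0]; apply/mem_set; split.
have row0 : m (0, 0)%N + m (0, 1)%N = n (0, 0)%N + n (0, 1)%N.
  move: eql; rewrite muE nuE' !big_cons !big_nil !rowE/= => -[].
  by rewrite !addr0.
have col0 : m (0, 0)%N + m (1, 0)%N = n (0, 0)%N + n (1, 0)%N.
  move: eqr; rewrite muE nuE' !big_cons !big_nil !colE/= => -[].
  by rewrite !addr0.
have n00 : n (0, 0)%N = m (0, 0)%N + e.
  rewrite /n nuE fineD ?fin_num_measure//; exact: measurable_nat2.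
have diffE A : (mu A - nu A)%E = (\sum_(x <- s | x \in A) (m x - n x))%:E.
  by rewrite muE nuE' -EFinB sumrB.
apply/eqP; rewrite eq_le; apply/andP; split.
  apply: ge_ereal_sup => _ [A _ <-]; rewrite diffE lee_fin !big_cons big_nil.
  by do 4 case: ifP => _; lra.
apply: ereal_sup_ubound; exists [set (0, 1)%N; (1, 0)%N] => //.
have in2 (x y z : nat * nat) : (x \in [set y; z]) = (x == y) || (x == z).
  apply/idP/orP => [/set_mem[]->|[]/eqP->]; rewrite ?eqxx; first by left.
  - by right.
  - by apply/mem_set; left.
  - by apply/mem_set; right.
rewrite diffE !big_cons big_nil !in2/=; congr EFin; lra.
Qed.

(** * Fermi-Dirac statistics *)

Section Configurations.
Context (L N : nat).

Definition config (A : {set 'I_L}) : L.-tuple nat :=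
  [tuple nat_of_bool (i \in A) | i < L].

Lemma config_inj : injective config.
Proof.
move=> A B AB; apply/setP => i.
have := congr1 (fun x => tnth x i) AB.
by rewrite !tnth_mktuple; do 2 case: (_ \in _).
Qed.

(** Avoiding [B] means being drawn from its complement. *)
Lemma card_layer_avoiding (B : {set 'I_L}) :
  #|[set A : {set 'I_L} | [disjoint B & A] & #|A| == N]%SET|
    = 'C(L - #|B|, N).
Proof.
have -> : (L - #|B| = #|~: B|)%N.
  by rewrite [in RHS]cardsCs finset.setCK card_ord.
rewrite -cards_draws; apply: eq_card => A.
by rewrite !inE disjoint_sym finset.disjoints_subset.
Qed.

Lemma measurable_tuple_nat (B : set (L.-tuple nat)) : measurable B.
Proof.
apply: countable_measurable; last exact: countableP.
move=> x; have -> : [set x] = \bigcap_(i in [set: 'I_L])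
    ((fun y : L.-tuple nat => tnth y i) @^-1` [set tnth x i]).
  apply/seteqP; split=> [_ -> //|y yx].
  by apply: eq_from_tnth => i; exact: yx.
apply: fin_bigcap_measurable => // i _; rewrite -[X in measurable X]setTI.
exact: measurable_tnth.
Qed.

Context (d : measure_display) (T : measurableType d) (R : realType).
Context (P : probability T R) (X : {RV P >-> L.-tuple nat}).
Hypotheses (NL : (N <= L)%N) (hX : fermi_dirac P N X).

(** The occupied sites form a uniform [N]-subset. The [N]-subsets are ['C(L, N)]
in number, so the configurations they define already exhaust the mass and
nothing is left for the other tuples of naturals. *)
Lemma fermi_dirac_prob (B : set (L.-tuple nat)) :
  P (X @^-1` B) =
    (#|[set A : {set 'I_L} | config A \in B & #|A| == N]%SET|%:R
      / 'C(L, N)%:R)%:E.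
Proof.
pose D := [set A : {set 'I_L} | #|A| == N]%SET.
pose s := [seq config A | A <- enum D].
have us : uniq s by rewrite map_inj_uniq ?enum_uniq//; exact: config_inj.
have lawE A : A \in D ->
    distribution P X [set config A] = ('C(L, N)%:R^-1)%:E.
  rewrite inE => AN; rewrite /distribution/= /pushforward.
  have := hX (config A); rewrite /preimage/= => ->; rewrite ifT//.
  apply/andP; split.
    by apply/forallP => k; rewrite tnth_mktuple !inE; case: (_ \in _).
  rewrite -(eqP AN) -sum1_card; apply/eqP; rewrite [RHS]big_mkcond/=.
  by apply: eq_bigr => i _; rewrite tnth_mktuple; case: (_ \in _).
have sum_law (Q : pred (L.-tuple nat)) :
    (\sum_(x <- s | Q x) distribution P X [set x])%E =
      (#|[set A in D | Q (config A)]%SET|%:R / 'C(L, N)%:R)%:E.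
  rewrite big_map big_enum_cond/= (eq_bigr (fun=> ('C(L, N)%:R^-1)%:E)).
    rewrite sumEFin big_const iter_addr_0 mulr_natl; congr (_ *+ _)%:E.
    by apply: eq_card => A; rewrite [RHS]inE.
  by move=> A /andP[AD _]; exact: lawE.
have tot : distribution P X [set` s] = 1%E.
  rewrite (measure_seq measurable_tuple_nat)// (sum_law predT).
  have -> : [set A in D | predT (config A)]%SET = D.
    by apply/setP => A; rewrite !inE andbT.
  by rewrite card_draws card_ord divff// pnatr_eq0 -lt0n bin_gt0.
rewrite -[LHS]/(distribution P X B).
rewrite (probability_finite_support measurable_tuple_nat _ us tot).
rewrite (sum_law (fun x => x \in B)); congr (_%:R / _)%:E.
by apply: eq_card => A; rewrite !inE andbC.
Qed.

Lemma fermi_dirac_config (B : set (L.-tuple nat)) :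
  range config `<=` B -> P (X @^-1` B) = 1%E.
Proof.
move=> configB; rewrite fermi_dirac_prob (_ : #|_| = 'C(L, N)).
  by rewrite divff// pnatr_eq0 -lt0n bin_gt0.
rewrite -[L in RHS]card_ord -card_draws; apply: eq_card => A.
by rewrite !inE mem_set//; apply: configB; exists A.
Qed.

Lemma fermi_dirac_vacant (B : {set 'I_L}) :
  P (X @^-1` [set x | forall k, k \in B -> tnth x k = 0%N]) =
    ('C(L - #|B|, N)%:R / 'C(L, N)%:R)%:E.
Proof.
rewrite fermi_dirac_prob -card_layer_avoiding; congr (_%:R / _)%:E.
apply: eq_card => A; rewrite !inE; congr (_ && _).
rewrite disjoint_subset; apply/idP/fintype.subsetP => [/set_mem/= BA k kB|BA].
  by have := BA _ kB; rewrite tnth_mktuple inE; case: (_ \in _).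
apply/mem_set => k kB /=; have := BA _ kB.
by rewrite tnth_mktuple inE; case: (_ \in _).
Qed.

End Configurations.

(** Over the naturals the factor [n - m] is truncated. With a true difference
the identity survives when [n < m], because both binomials then vanish; this
spares a case distinction at [N = L]. *)
Lemma natr_mul_bin_down (R : comNzRingType) (n m : nat) :
  n%:R * 'C(n.-1, m)%:R = (n%:R - m%:R) * 'C(n, m)%:R :> R.
Proof.
have [mn|nm] := leqP m n; first by rewrite -natrB// -!natrM mul_bin_down.
by rewrite !bin_small ?mulr0//; exact: leq_ltn_trans (leq_pred n) nm.
Qed.

Lemma bernoulli_nat_bits (R : realType) (p : R) : bernoulli_nat p bits = 1%E.
Proof.
rewrite /bernoulli_nat /distribution/= /pushforward.
rewrite -(probability_setT (bernoulli_prob p)); congr (bernoulli_prob p _).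
by apply/seteqP; split=> // b _; exists b.
Qed.

Lemma bernoulli_nat0 (R : realType) (p : R) :
  0 <= p <= 1 -> bernoulli_nat p [set 0%N] = (1 - p)%:E.
Proof.
move=> p01; rewrite /bernoulli_nat /distribution/= /pushforward.
have -> : nat_of_bool @^-1` [set 0%N] = [set false].
  by apply/seteqP; split=> [[]|_ ->].
by rewrite /bernoulli_prob p01 fsbig_set1.
Qed.

Theorem theorem3p1 (R : realType) (d : measure_display) (T : measurableType d)
    (P : probability T R) (L N : nat) (hL : (2 <= L)%N) (hN : (N <= L)%N)
    (X : {RV P >-> L.-tuple nat}) (hX : fermi_dirac P N X) :
  let gammaLN := pair_law P X (Ordinal (ltnW hL)) (Ordinal hL) in
  let lambda := bernoulli_nat (N%:R / L%:R : R) in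
  tv_dist gammaLN (lambda \x lambda)%E =
    (2 * N%:R / (L%:R * (L%:R - 1)) * (1 - N%:R / L%:R))%:E.
Proof.
set i := Ordinal (ltnW hL); set j := Ordinal hL => gamma lambda.
have ij : i != j by [].
have L0 : L%:R != 0 :> R by rewrite pnatr_eq0 -lt0n ltnW.
have L1 : L%:R - 1 != 0 :> R by rewrite subr_eq0 pnatr_eq1 gtn_eqF.
have C0 : 'C(L, N)%:R != 0 :> R by rewrite pnatr_eq0 -lt0n bin_gt0.
have Lgt0 : 0 < L%:R :> R by rewrite ltr0n ltnW.
have Lgt1 : 0 < L%:R - 1 :> R by rewrite subr_gt0 ltr1n.
have NL : N%:R / L%:R <= 1 :> R by rewrite ler_pdivrMr// mul1r ler_nat.
have p01 : 0 <= (N%:R / L%:R : R) <= 1 by rewrite divr_ge0//= ler0n.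
(* Probabilities that one, resp. two, prescribed sites are vacant. *)
have C1 : 'C(L - 1, N)%:R / 'C(L, N)%:R = 1 - N%:R / L%:R :> R.
  apply: (mulfI L0); rewrite mulrA subn1 natr_mul_bin_down; field.
  by rewrite L0 C0.
have C2 : 'C(L - 2, N)%:R / 'C(L, N)%:R =
    (1 - N%:R / L%:R) * (1 - N%:R / (L%:R - 1)) :> R.
  rewrite -C1; apply: (mulfI L1).
  have L1E : L%:R - 1 = L.-1%:R :> R by rewrite -subn1 natrB// ltnW.
  rewrite mulrA subn1 subn2 L1E natr_mul_bin_down -L1E; field.
  by rewrite L1 C0.
have gammaE (V : set (nat * nat)) :
  gamma V = P (X @^-1` (coord_pair i j @^-1` V)) by [].
have gamma0 (k : 'I_L) :
    P (X @^-1` [set x | tnth x k = 0%N]) = (1 - N%:R / L%:R)%:E.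
  rewrite -C1 -(cards1 k) -(fermi_dirac_vacant hN hX); congr (P _).
  apply/seteqP; split=> w /= h; last by apply: h; rewrite inE.
  by move=> l; rewrite inE => /eqP->.
have lambdaT : lambda setT = 1%E by exact: probability_setT.
set lambda2 := (X in tv_dist _ X).
have lambda2E A B : lambda2 (A `*` B) = (lambda A * lambda B)%E.
  exact: product_measure1E.
have -> : 2 * N%:R / (L%:R * (L%:R - 1)) * (1 - N%:R / L%:R) =
    2 * (N%:R / (L%:R * (L%:R - 1)) * (1 - N%:R / L%:R)) :> R by rewrite !mulrA.
apply: tv_dist_bits.
- rewrite gammaE (fermi_dirac_config hN hX)// => _ [A _ <-].
  by split; rewrite /= tnth_mktuple; eexists.
- by rewrite lambda2E !bernoulli_nat_bits mule1.
- rewrite lambda2E lambdaT mule1 bernoulli_nat0// -(gamma0 i) gammaE.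
  by congr (P _); apply/seteqP; split=> w /= => [[]|].
- rewrite lambda2E lambdaT mul1e bernoulli_nat0// -(gamma0 j) gammaE.
  by congr (P _); apply/seteqP; split=> w /= => [[]|].
- apply: mulr_ge0; last by rewrite subr_ge0.
  by rewrite divr_ge0// mulr_ge0// ltW.
- have -> : [set (0, 0)%N] = [set 0%N] `*` [set 0%N].
    by apply/seteqP; split=> [_ ->|[a b] [/= -> ->]].
  rewrite lambda2E !bernoulli_nat0//.
  have -> : gamma ([set 0%N] `*` [set 0%N]) =
      ('C(L - 2, N)%:R / 'C(L, N)%:R)%:E.
    have c2 : #|[set i; j]%SET| = 2%N by rewrite cards2 ij.
    rewrite -c2 -(fermi_dirac_vacant hN hX) gammaE; congr (P _).
    apply/seteqP; split=> w /= => [[wi wj] k|h].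
      by rewrite !inE => /orP[]/eqP->.
    by split; apply: h; rewrite !inE eqxx ?orbT.
  rewrite C2 -EFinM -EFinD; congr EFin; field.
  by rewrite L0 L1.
Qed.
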